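(* Let $\mathcal T_h$ be a finite set of mesh elements; for each $T\in\mathcal T_h$ let $\mathcal N(T)\subseteq\{1,\dots,n\}$ be the set of global degree-of-freedom (DOF) indices supported on $T$, let $n_T=|\mathcal N(T)|$, and let $R_T:\mathbb R^n\to\mathbb R^{n_T}$ be the Boolean restriction to the coordinates in $\mathcal N(T)$. Let $A\in\mathbb R^{n\times n}$ be symmetric positive definite with $A=\sum_{T\in\mathcal T_h}R_T^\top A_TR_T$, where each $A_T\in\mathbb R^{n_T\times n_T}$ is symmetric positive semidefinite. For each $T$ let $G_T\in\mathbb R^{m_T\times n_T}$ satisfy $A_T=G_T^\top G_T$, and let $G\in\mathbb R^{m\times n}$, $m=\sum_{T}m_T$, be obtained by vertically stacking the blocks $G_TR_T$, $T\in\mathcal T_h$, so that $A=G^\top G$. For any DOF set $\omega\subseteq\{1,\dots,n\}$, let $\Omega^G(\omega)$ denote its $G$-row closure and $\Omega_{\mathrm{cl}}(\omega)$ its element-closure DOF set. Then $$\Omega^G(\omega)\subseteq\Omega_{\mathrm{cl}}(\omega).$$ If, in addition, for every $T\in\mathcal T_h$ the matrix $G_T$ has at least one row all of whose $n_T$ entries are nonzero, then $$\Omega^G(\omega)=\Omega_{\mathrm{cl}}(\omega).$$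
   Context: The Boolean restriction to a set $X\subseteq\{1,\dots,n\}$ is the matrix formed by the rows of the $n\times n$ identity matrix indexed by $X$. $G$-row closure: write the rows of $G$ as $\bm g_1^\top,\dots,\bm g_m^\top$ with $\bm g_j\in\mathbb R^n$, and $\operatorname{supp}(\bm g_j)=\{k:(\bm g_j)_k\neq0\}$. For $\omega\subseteq\{1,\dots,n\}$ the row-touching set is $\mathfrak R_\omega=\{j\in\{1,\dots,m\}:\operatorname{supp}(\bm g_j)\cap\omega\neq\emptyset\}$, and the $G$-row closure is $\Omega^G(\omega)=\bigcup_{j\in\mathfrak R_\omega}\operatorname{supp}(\bm g_j)$. Element closure: for $\omega\subseteq\{1,\dots,n\}$, the element closure is $\operatorname{cl}_T(\omega)=\{T\in\mathcal T_h:\mathcal N(T)\cap\omega\neq\emptyset\}$ (the subscript $T$ is part of the notation), and the element-closure DOF set is $\Omega_{\mathrm{cl}}(\omega)=\bigcup_{T\in\operatorname{cl}_T(\omega)}\mathcal N(T)\subseteq\{1,\dots,n\}$. *)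

(* Defs.v *)
From mathcomp Require Import all_boot all_order all_algebra.
From mathcomp Require Import reals.

Set Implicit Arguments.
Unset Strict Implicit.
Unset Printing Implicit Defensive.

Import Order.TTheory GRing.Theory Num.Theory.
Local Open Scope ring_scope.

Definition sym_pos_def (R : realType) (n : nat) (A : 'M[R]_n) : Prop :=
  A^T = A /\ forall x : 'cV[R]_n, x != 0 -> 0 < (x^T *m A *m x) 0 0.

Definition sym_pos_semidef (R : realType) (n : nat) (A : 'M[R]_n) : Prop :=
  A^T = A /\ forall x : 'cV[R]_n, 0 <= (x^T *m A *m x) 0 0.

(* The rows of the identity matrix indexed by X, in increasing order of index:
   enum_val is the enumeration of X by 'I_#|X|. *)
Definition bool_restr (R : realType) (n : nat) (X : {set 'I_n}) :
    'M[R]_(#|X|, n) :=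
  rowsub (fun i : 'I_#|X| => enum_val i) 1%:M.

(* Vertical stacking of a family of blocks indexed by a finite type Th, from
   top to bottom in the order e 0, e 1, ...; e is meant to be bijective, so
   that the number of rows is the sum of m T over all T : Th. *)
Definition vstack (R : realType) (Th : finType) (n : nat) (m : Th -> nat)
    (e : 'I_#|Th| -> Th) (B : forall T : Th, 'M[R]_(m T, n)) :
    'M[R]_(\sum_(i < #|Th|) m (e i), n) :=
  \mxcol_(i < #|Th|) B (e i).

Definition supp (R : realType) (n : nat) (g : 'rV[R]_n) : {set 'I_n} :=
  [set k | g 0 k != 0].

Definition row_touching (R : realType) (m n : nat) (G : 'M[R]_(m, n))
    (w : {set 'I_n}) : {set 'I_m} :=
  [set j | supp (row j G) :&: w != set0].

Definition row_closure (R : realType) (m n : nat) (G : 'M[R]_(m, n))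
    (w : {set 'I_n}) : {set 'I_n} :=
  \bigcup_(j in row_touching G w) supp (row j G).

Definition elt_closure (Th : finType) (n : nat) (N : Th -> {set 'I_n})
    (w : {set 'I_n}) : {set Th} :=
  [set T | N T :&: w != set0].

Definition elt_closure_dofs (Th : finType) (n : nat) (N : Th -> {set 'I_n})
    (w : {set 'I_n}) : {set 'I_n} :=
  \bigcup_(T in elt_closure N w) N T.

(* Main.v *)
Require Import Defs.
From mathcomp Require Import all_boot all_order all_algebra.
From mathcomp Require Import reals.

Import Order.TTheory GRing.Theory Num.Theory.
Local Open Scope ring_scope.

(** Every row of [G] comes from a single block [G_T R_T], and right multiplication by [R_T] only
    places the entries of a row of [G_T] at the positions in [N T], with zeros elsewhere. So its
    support lies in [N T] ([supp_row_mul_bool_restr]); if it meets [w], so does [N T]. Conversely, a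
    row of [G_T] without zeros has support exactly [N T] ([supp_row_mul_bool_restr_full]), so when
    [N T] meets [w] this one row contributes all of [N T]. *)

Lemma mul_bool_restrE (R : realType) (m n : nat) (X : {set 'I_n})
    (M : 'M[R]_(m, #|X|)) (i : 'I_m) (k : 'I_#|X|) :
  (M *m bool_restr R X) i (enum_val k) = M i k.
Proof.
rewrite mxE (bigD1 k) //= !mxE eqxx mulr1 big1 ?addr0 // => l lk.
by rewrite !mxE (inj_eq enum_val_inj) (negbTE lk) mulr0.
Qed.

(** The columns of [bool_restr R X] with index outside [X] vanish. *)
Lemma supp_row_mul_bool_restr (R : realType) (m n : nat) (X : {set 'I_n})
    (M : 'M[R]_(m, #|X|)) (i : 'I_m) :
  supp (row i (M *m bool_restr R X)) \subset X.
Proof.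
apply/subsetP => k; rewrite inE; apply: contraR => kX.
rewrite !mxE big1 // => l _; rewrite !mxE.
case: eqP => [lk|_]; last exact: mulr0.
by rewrite -lk enum_valP in kX.
Qed.

Lemma supp_row_mul_bool_restr_full (R : realType) (m n : nat)
    (X : {set 'I_n}) (M : 'M[R]_(m, #|X|)) (i : 'I_m) :
  (forall k, M i k != 0) -> supp (row i (M *m bool_restr R X)) = X.
Proof.
move=> Mi; apply/eqP; rewrite eqEsubset supp_row_mul_bool_restr /=.
apply/subsetP => k kX.
by rewrite inE mxE -(enum_rankK_in kX kX) mul_bool_restrE.
Qed.

Theorem theorem5p7 (R : realType) (n : nat) (Th : finType)
    (N : Th -> {set 'I_n})
    (A : 'M[R]_n) (A_ : forall T : Th, 'M[R]_#|N T|)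
    (hA : sym_pos_def A)
    (hA_ : forall T : Th, sym_pos_semidef (A_ T))
    (hAsum : A = \sum_(T : Th)
       (bool_restr R (N T))^T *m A_ T *m bool_restr R (N T))
    (m_ : Th -> nat) (G_ : forall T : Th, 'M[R]_(m_ T, #|N T|))
    (hG_ : forall T : Th, A_ T = (G_ T)^T *m G_ T)
    (e : 'I_#|Th| -> Th) (he : bijective e)
    (G : 'M[R]_(\sum_(i < #|Th|) m_ (e i), n))
    (hG : G = vstack e (fun T : Th => G_ T *m bool_restr R (N T)))
    (w : {set 'I_n}) :
  row_closure G w \subset elt_closure_dofs N w /\
  ((forall T : Th, exists i : 'I_(m_ T), forall k : 'I_#|N T|, G_ T i k != 0) ->
   row_closure G w = elt_closure_dofs N w).
Proof.
rewrite {}hG.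
set B := fun T => G_ T *m bool_restr R (N T).
(* A global row index [j] splits into its block [tagnat.sig1 j] and its position [tagnat.sig2 j] in
   that block. *)
have rowG j : row j (vstack e B) = row (tagnat.sig2 j) (B (e (tagnat.sig1 j))).
  exact: row_mxcol.
have sub : row_closure (vstack e B) w \subset elt_closure_dofs N w.
  apply/bigcupsP => j; rewrite inE rowG => /set0Pn[k /setIP[kj kw]].
  have sB :=
    supp_row_mul_bool_restr _ _ _ _ (G_ (e (tagnat.sig1 j))) (tagnat.sig2 j).
  apply: (subset_trans sB); apply: bigcup_sup; rewrite inE.
  by apply/set0Pn; exists k; rewrite inE kw (subsetP sB).
split=> // full; apply/eqP; rewrite eqEsubset sub /=.
apply/bigcupsP => T; rewrite inE; case: he => e' _ e'K.
(* Surjectivity of [e] guarantees that the block of [T] occurs in the stack, at position [t]. *)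
rewrite -(e'K T); set t := e' T => Tw.
have [i /supp_row_mul_bool_restr_full Ni] := full (e t).
have suppG : supp (row (tagnat.Rank t i) (vstack e B)) = N (e t).
  (* Block [t] is read back from the stack; using [rowG] here would require a cast along
     [tagnat.sig1 (tagnat.Rank t i) = t]. *)
  rewrite -[RHS]Ni -/(B (e t)) -[B (e t)](mxcolK (fun s => B (e s)) t).
  by congr supp; apply/rowP => k; rewrite !mxE.
by rewrite -suppG; apply: bigcup_sup; rewrite inE suppG.
Qed.
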